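(* Let $m,n\ge 1$ be integers, let $A_C(m,n)$ be the single-column graph with reward function $r$ and unit edge costs, and let $B$ be a positive integer budget. There is an algorithm that solves the single-column constant-cost orienteering problem COP-SC on $(A_C(m,n),r,B)$ optimally, i.e. that outputs a closed walk in $A_C(m,n)$ starting and ending at $v_{1,0}$ of cost at most $B$ whose collected reward is maximum among all such closed walks, and it runs in time $\mathcal{O}(m\,n\,\tfrac{B}{2})$.
   Context: The single-column graph $A_C(m,n)=(V,E)$ has vertex set $V=\{v_{i,j}: 1\le i\le m,\ 0\le j\le n\}$ (rows $i$, columns $j$). Its edges are the horizontal edges $\{v_{i,j},v_{i,j+1}\}$ for $1\le i\le m$, $0\le j\le n-1$, and the vertical edges $\{v_{i,0},v_{i+1,0}\}$ for $1\le i\le m-1$; thus rows are interconnected only through column $0$ (a comb-shaped graph), and a robot can change row only in column $0$. Every edge has cost $1$. A reward function $r:V\to\mathbb{R}_{\ge 0}$ is given with $r(v_{i,0})=0$ for all $i$. The cost of a walk is its number of edge traversals (counted with multiplicity); the reward collected by a walk is the sum of $r(v)$ over the distinct vertices $v$ it visits (each vertex's reward is collected at most once). COP-SC asks for a closed walk in $A_C(m,n)$ starting and ending at $v_{1,0}$ of cost at most $B$ with maximum collected reward. Running time is measured with unit-cost arithmetic and comparison operations on rewards. *)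

(* Defs.v *)
From HB Require Import structures.
From mathcomp Require Import all_boot all_order all_algebra.
From mathcomp Require Import reals.

Set Implicit Arguments.
Unset Strict Implicit.
Unset Printing Implicit Defensive.

Import Order.TTheory GRing.Theory Num.Theory.
Local Open Scope ring_scope.

(** * The single-column graph and COP-SC *)

(* Rows are shifted by one: the pair (i, j) stands for v_{i+1,j}. *)
Definition vertex (m n : nat) : Type := ('I_m * 'I_n.+1)%type.

Section Graph.
Variables m n : nat.
Implicit Types (u v : vertex m n) (w : seq (vertex m n)).

Definition hedge u v : bool := (u.1 == v.1) && (v.2 == u.2.+1 :> nat).

Definition vedge u v : bool :=
  [&& u.2 == 0%N :> nat, v.2 == 0%N :> nat & v.1 == u.1.+1 :> nat].

Definition adj : rel (vertex m n) :=
  fun u v => [|| hedge u v, hedge v u, vedge u v | vedge v u].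

Definition is_origin v : bool := (v.1 == 0%N :> nat) && (v.2 == 0%N :> nat).

(* A walk is the nonempty sequence of its successive vertices, the first and
   the last one included. *)
Definition closed_walk w : bool :=
  if w is v :: p then [&& is_origin v, path adj v p & last v p == v] else false.

Definition cost w : nat := (size w).-1.

Definition collected (R : realType) (r : vertex m n -> R) w : R :=
  \sum_(v in w) r v.

Definition cop_sc_optimal (R : realType) (r : vertex m n -> R) (B : nat) w :
    Prop :=
  [/\ closed_walk w, (cost w <= B)%N
    & forall w', closed_walk w' -> (cost w' <= B)%N ->
        collected r w' <= collected r w].

End Graph.

(** * Algorithms: while programs over a random access memory, unit cost

  Naturals (sizes, indices, addresses) and rewards live in separate registers
  and arrays. Naturals only have addition, truncated subtraction and comparison,
  so that no work can be hidden in products of large integers; rewards have the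
  field operations and comparison, and cannot be turned into naturals. *)

Inductive nexp : Type :=
| NConst of nat
| NReg of nat
| NArr of nat & nexp
| NAdd of nexp & nexp
| NSub of nexp & nexp.

Inductive rexp : Type :=
| RZero
| ROne
| RReg of nat
| RArr of nat & nexp
| RAdd of rexp & rexp
| RSub of rexp & rexp
| RMul of rexp & rexp
| RDiv of rexp & rexp.

Inductive bexp : Type :=
| NLe of nexp & nexp
| RLe of rexp & rexp
| BNot of bexp
| BAnd of bexp & bexp.

Inductive prog : Type :=
| Skip
| NSet of nat & nexp
| NStore of nat & nexp & nexp
| RSet of nat & rexp
| RStore of nat & nexp & rexp
| Seq of prog & prog
| If of bexp & prog & prog
| While of bexp & prog.

Fixpoint nexp_time (e : nexp) : nat :=
  match e with
  | NConst _ | NReg _ => 1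
  | NArr _ e1 => (nexp_time e1).+1
  | NAdd e1 e2 | NSub e1 e2 => (nexp_time e1 + nexp_time e2).+1
  end.

Fixpoint rexp_time (e : rexp) : nat :=
  match e with
  | RZero | ROne | RReg _ => 1
  | RArr _ e1 => (nexp_time e1).+1
  | RAdd e1 e2 | RSub e1 e2 | RMul e1 e2 | RDiv e1 e2 =>
      (rexp_time e1 + rexp_time e2).+1
  end.

Fixpoint bexp_time (e : bexp) : nat :=
  match e with
  | NLe e1 e2 => (nexp_time e1 + nexp_time e2).+1
  | RLe e1 e2 => (rexp_time e1 + rexp_time e2).+1
  | BNot e1 => (bexp_time e1).+1
  | BAnd e1 e2 => (bexp_time e1 + bexp_time e2).+1
  end.

Record state (R : realType) : Type := State {
  nreg : nat -> nat;
  narr : nat -> nat -> nat;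
  rreg : nat -> R;
  rarr : nat -> nat -> R }.

Definition upd (T : Type) (f : nat -> T) (x : nat) (a : T) : nat -> T :=
  fun y => if y == x then a else f y.

Section Semantics.
Variable R : realType.
Implicit Types s : state R.

Definition set_nreg s x a := State (upd (nreg s) x a) (narr s) (rreg s) (rarr s).

Definition set_narr s x k a :=
  State (nreg s) (upd (narr s) x (upd (narr s x) k a)) (rreg s) (rarr s).

Definition set_rreg s x a := State (nreg s) (narr s) (upd (rreg s) x a) (rarr s).

Definition set_rarr s x k a :=
  State (nreg s) (narr s) (rreg s) (upd (rarr s) x (upd (rarr s x) k a)).

Fixpoint neval s (e : nexp) : nat :=
  match e with
  | NConst c => c
  | NReg x => nreg s x
  | NArr x e1 => narr s x (neval s e1)
  | NAdd e1 e2 => (neval s e1 + neval s e2)%N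
  | NSub e1 e2 => (neval s e1 - neval s e2)%N
  end.

Fixpoint reval s (e : rexp) : R :=
  match e with
  | RZero => 0
  | ROne => 1
  | RReg x => rreg s x
  | RArr x e1 => rarr s x (neval s e1)
  | RAdd e1 e2 => reval s e1 + reval s e2
  | RSub e1 e2 => reval s e1 - reval s e2
  | RMul e1 e2 => reval s e1 * reval s e2
  | RDiv e1 e2 => reval s e1 / reval s e2
  end.

Fixpoint beval s (e : bexp) : bool :=
  match e with
  | NLe e1 e2 => (neval s e1 <= neval s e2)%N
  | RLe e1 e2 => reval s e1 <= reval s e2
  | BNot e1 => ~~ beval s e1
  | BAnd e1 e2 => beval s e1 && beval s e2
  end.

(* [exec p s s' t]: started in s, p halts in s' after t elementary steps. *)
Inductive exec : prog -> state R -> state R -> nat -> Prop :=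
| ExecSkip s : exec Skip s s 1
| ExecNSet s x e :
    exec (NSet x e) s (set_nreg s x (neval s e)) (nexp_time e).+1
| ExecNStore s x i e :
    exec (NStore x i e) s (set_narr s x (neval s i) (neval s e))
      (nexp_time i + nexp_time e).+1
| ExecRSet s x e :
    exec (RSet x e) s (set_rreg s x (reval s e)) (rexp_time e).+1
| ExecRStore s x i e :
    exec (RStore x i e) s (set_rarr s x (neval s i) (reval s e))
      (nexp_time i + rexp_time e).+1
| ExecSeq p q s s1 s2 t1 t2 :
    exec p s s1 t1 -> exec q s1 s2 t2 -> exec (Seq p q) s s2 (t1 + t2)
| ExecIf b p q s s' t :
    exec (if beval s b then p else q) s s' t ->
    exec (If b p q) s s' (bexp_time b + t).+1
| ExecWhileEnd b p s :
    ~~ beval s b -> exec (While b p) s s (bexp_time b).+1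
| ExecWhileStep b p s s1 s2 t1 t2 :
    beval s b -> exec p s s1 t1 -> exec (While b p) s1 s2 t2 ->
    exec (While b p) s s2 (bexp_time b + t1 + t2).+1.

(* Hence exhibiting one halting execution describes the behaviour of p on s. *)
Lemma exec_det p s s1 s2 t1 t2 :
  exec p s s1 t1 -> exec p s s2 t2 -> s1 = s2 /\ t1 = t2.
Proof.
move=> h1; elim: h1 s2 t2 => {p s s1 t1}
  [s|s x e|s x i e|s x e|s x i e|p q s sa sb ta tb _ IHp _ IHq
  |b p q s sa ta _ IH|b p s nb|b p s sa sb ta tb hb _ IHp _ IHw] s' t' h;
  inversion h as [| | | | | ? ? ? ? ? ? ? h1 h2 | ? ? ? ? ? ? h1
    | ? ? ? h1 | ? ? ? ? ? ? ? h0 h1 h2]; subst => //.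
- by have [? ?] := IHp _ _ h1; subst; have [-> ->] := IHq _ _ h2.
- by have [-> ->] := IH _ _ h1.
- by rewrite h0 in nb.
- by rewrite hb in h1.
- by have [? ?] := IHp _ _ h1; subst; have [-> ->] := IHw _ _ h2.
Qed.

End Semantics.

(** * Input and output conventions *)

Section InputOutput.
Variables (R : realType) (m n : nat).

(* Row-major address of a vertex in the input reward array. *)
Definition address (v : vertex m n) : nat := (v.1 * n.+1 + v.2)%N.

(* Registers 0, 1, 2 hold m, n, B and reward array 0 holds r; all other
   registers and cells are 0. *)
Definition input_state (r : vertex m n -> R) (B : nat) : state R :=
  State (nth 0%N [:: m; n; B])
        (fun _ _ => 0%N)
        (fun _ => 0)
        (fun x k => if x == 0%N then
                      if [pick v | address v == k] is Some v then r v else 0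
                    else 0).

(* Register 3 holds the number of vertices of the output walk; arrays 0 and 1
   hold their rows (numbered from 1) and their columns. *)
Definition output (s : state R) : seq (nat * nat) :=
  [seq (narr s 0 k, narr s 1 k) | k <- iota 0 (nreg s 3)].

Definition walk_code (w : seq (vertex m n)) : seq (nat * nat) :=
  [seq (v.1.+1, nat_of_ord v.2) | v : vertex m n <- w].

End InputOutput.

(* Main.v *)
Require Import Defs.
From HB Require Import structures.
From mathcomp Require Import all_boot all_order all_algebra.
From mathcomp Require Import reals zify ring lra.

Set Implicit Arguments.
Unset Strict Implicit.
Unset Printing Implicit Defensive.

Import Order.TTheory GRing.Theory Num.Theory.
Local Open Scope ring_scope.

(* Let H = B./2. The comb is a tree, so a closed walk of cost at most B visits a
   subtree containing the root and at most H further vertices; conversely such a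
   subtree can be toured within the budget. Listing the vertices of the subtree
   row by row, each one is followed either by its outer neighbour or by the first
   vertex of the next row. This gives a dynamic program over (edges left, vertex)
   with two choices per state, hence O(H m n) states and constant work for each.
   The optimal tour is then read off the table, recomputing the choice at every
   step; twice the number of edges left plus the distance back to the root drops
   by one with each edge traversed. *)

(** * Closed walks in the comb *)

Section Comb.
Variables m n : nat.
Implicit Types (u v : vertex m n) (V : {set vertex m n}).

Definition parent u v : bool := hedge u v || vedge u v.

Definition depth v : nat := (v.1 + v.2)%N.

Definition parent_closed V := forall u v, v \in V -> parent u v -> u \in V.

Lemma vertex_eq u v : u.1 = v.1 :> nat -> u.2 = v.2 :> nat -> u = v.
Proof.
by case: u v => [u1 u2] [v1 v2] /= /val_inj-> /val_inj->.
Qed.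

Lemma adj_parent u v : adj u v = parent u v || parent v u.
Proof. by rewrite /adj /parent; do !case: (_ u v); do !case: (_ v u). Qed.

Lemma parentP u v : parent u v ->
  [/\ u.1 = v.1 :> nat & v.2 = u.2.+1 :> nat] \/
  [/\ u.2 = 0%N :> nat, v.2 = 0%N :> nat & v.1 = u.1.+1 :> nat].
Proof.
case/orP => [/andP[/eqP-> /eqP->]|/and3P[/eqP ? /eqP ? /eqP ?]]; first by left.
by right.
Qed.

Lemma depth_parent u v : parent u v -> depth v = (depth u).+1.
Proof. by rewrite /depth => /parentP [[? ?]|[? ? ?]]; lia. Qed.

Lemma parent_inj u u' v : parent u v -> parent u' v -> u = u'.
Proof.
by move=> /parentP [[? ?]|[? ? ?]] /parentP [[? ?]|[? ? ?]]; apply: vertex_eq; lia.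
Qed.

(** Induct on the last step. The visited set is closed under [parent], so a new vertex is reached
    only from its parent, and then the count and the depth both grow by one. A step to an old vertex
    lengthens the walk by one and lowers the depth by at most one. *)
Lemma path_visited v0 p : is_origin v0 -> path (@adj m n) v0 p ->
  parent_closed [set x in v0 :: p] /\
  (2 * #|[set x in v0 :: p]| <= size p + depth (last v0 p) + 2)%N.
Proof.
move=> /andP[/eqP o1 /eqP o2]; elim/last_ind: p => [_|p y IH].
  split; last by rewrite set_cons set_nil setU0 cards1; lia.
  move=> u v; rewrite !inE => /eqP-> /parentP [[_]|[_ _]]; lia.
rewrite rcons_path last_rcons size_rcons => /andP[/IH [clV leV] axy].
have memy : [set x in v0 :: rcons p y] = y |: [set x in v0 :: p].
  by apply/setP => x; rewrite !inE mem_rcons inE orbCA.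
have lastV : last v0 p \in [set x in v0 :: p] by rewrite inE mem_last.
rewrite memy; have [yV|yV] := boolP (y \in [set x in v0 :: p]).
  rewrite (setUidPr _) ?sub1set //; split => //.
  by move: axy; rewrite adj_parent => /orP[] /depth_parent; lia.
have xy : parent (last v0 p) y.
  move: axy; rewrite adj_parent => /orP[//|yx].
  by rewrite (clV _ _ lastV yx) in yV.
split; last by rewrite cardsU1 yV (depth_parent xy); lia.
move=> u v; rewrite 2!in_setU1 => /orP[/eqP->|vV] uv.
  by rewrite (parent_inj uv xy) lastV orbT.
by rewrite (clV _ _ vV uv) orbT.
Qed.

Lemma closed_walk_visited w : closed_walk w ->
  parent_closed [set x in w] /\ (2 * #|[set x in w]|.-1 <= cost w)%N.
Proof.
case: w => // v p /and3P[ov pth /eqP lst].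
have [? le] := path_visited ov pth; split=> //; move: le.
by rewrite lst /cost /= /depth; case/andP: ov => /eqP-> /eqP->; lia.
Qed.

Lemma parent_closed_col V (v : vertex m n) (i : 'I_n.+1) :
  parent_closed V -> v \in V -> (i <= v.2)%N -> (v.1, i) \in V.
Proof.
move=> clV; case: v => k j /= jV le.
have [d dE] : exists d, d = (j - i)%N by eexists.
elim: d => [|d IH] in j jV le dE *.
  by rewrite (_ : i = j) //; apply: val_inj => /=; lia.
have lt : (j.-1 < n.+1)%N by have := ltn_ord j; lia.
apply: (IH (Ordinal lt)) => /=; try lia.
apply: clV jV _; rewrite /parent /hedge /= eqxx /=; apply/orP; left; lia.
Qed.

Lemma parent_closed_row V (v : vertex m n) (i : 'I_m) :
  parent_closed V -> v \in V -> (i <= v.1)%N -> (i, ord0) \in V.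
Proof.
move=> clV vV; have {vV} := parent_closed_col (i := ord0) clV vV isT.
case: v => k _ /= kV le.
have [d dE] : exists d, d = (k - i)%N by eexists.
elim: d => [|d IH] in k kV le dE *.
  by rewrite (_ : i = k) //; apply: val_inj => /=; lia.
have lt : (k.-1 < m)%N by have := ltn_ord k; lia.
apply: (IH (Ordinal lt)) => /=; try lia.
apply: clV kV _; rewrite /parent /vedge /=; apply/orP; right; apply/eqP; lia.
Qed.

(** Strictly after position [(k, j)] in row-by-row reading order: the vertices that a state of the
    dynamic program may still collect. *)
Definition lexlt (k j : nat) v : bool :=
  (k < v.1)%N || (k == v.1 :> nat) && (j < v.2)%N.

End Comb.

(** * The value function *)

Section Value.
Variables (R : realType) (m n : nat) (rho : nat -> R).

(* [gain b k j] is the largest reward that can still be collected at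
   [v_{k+1,j}], reached by walking straight out from column 0, when [b]
   further edges may be used (each of them being traversed back and forth).
   The addresses of [rho] are those of the input array. *)
Fixpoint gain (b k j : nat) : R :=
  if b is b'.+1 then
    let down := if (k.+1 < m)%N then gain b' k.+1 0%N else 0 in
    let out := rho (k * n.+1 + j).+1 + gain b' k j.+1 in
    if (j < n)%N && (down <= out) then out else down
  else 0.

(** The values of the two choices. Column 0 carries no reward, so going down adds none; below the
    last row nothing is left to collect. *)
Definition gain_down b k : R := if (k.+1 < m)%N then gain b k.+1 0%N else 0.
Definition gain_out b k j : R := rho (k * n.+1 + j).+1 + gain b k j.+1.

Lemma gainS b k j : gain b.+1 k j =
  if (j < n)%N && (gain_down b k <= gain_out b k j) then gain_out b k j
  else gain_down b k.
Proof. by []. Qed.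

Hypothesis rho_ge0 : forall a, 0 <= rho a.

Lemma gain_ge0 b k j : 0 <= gain b k j.
Proof.
elim: b => [|b IH] in k j *; first by [].
rewrite gainS; case: ifP => _; first by rewrite addr_ge0.
by rewrite /gain_down; case: ifP.
Qed.

Lemma gain_down_le b k j : gain_down b k <= gain b.+1 k j.
Proof. by rewrite gainS; case: ifP => // /andP[]. Qed.

Lemma gain_out_le b k j : (j < n)%N -> gain_out b k j <= gain b.+1 k j.
Proof. by move=> lt; rewrite gainS lt; case: ifPn => //; rewrite -ltNge => /ltW. Qed.

Variable r : vertex m n -> R.
Hypothesis rhoE : forall v, rho (address v) = r v.
Hypothesis r_col0 : forall i : 'I_m, r (i, ord0) = 0.

(** Induct on [b], removing the first vertex [u] of [V] after [(k, j)]. Since [V] is closed under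
    [parent], [u] is [(k, j.+1)] when [V] reaches further out in row [k], and [(k.+1, 0)] otherwise:
    the two choices of [gain]. *)
Lemma lex_sum_le_gain (V : {set vertex m n}) b k j : parent_closed V ->
  (#|[set v in V | lexlt k j v]| <= b)%N ->
  \sum_(v in V | lexlt k j v) r v <= gain b k j.
Proof.
move=> clV; elim: b => [|b IH] in k j *.
  rewrite leqn0 cards_eq0 => /eqP e0; rewrite big_pred0 // => v.
  by move/setP/(_ v): e0; rewrite !inE.
(* Removing the first vertex [u] leaves exactly the vertices after [u], to which the induction
   hypothesis applies. *)
have step (u : vertex m n) : u \in V -> lexlt k j u ->
    (forall v, v \in V -> lexlt k j v -> v = u \/ lexlt u.1 u.2 v) ->
    (#|[set v in V | lexlt k j v]| <= b.+1)%N ->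
    \sum_(v in V | lexlt k j v) r v <= r u + gain b u.1 u.2.
  move=> uV ltu minu leb; rewrite (bigD1 u) /=; last by rewrite uV.
  have eqs v : (v \in V) && lexlt k j v && (v != u) =
               (v \in V) && lexlt u.1 u.2 v.
    apply/idP/idP => [/andP[/andP[vV ltv] /eqP neq]|/andP[vV ltv]].
      by rewrite vV; case: (minu v vV ltv).
    rewrite vV /=; move: ltu ltv; rewrite /lexlt => ltu ltv.
    apply/andP; split; first by lia.
    by apply: contraTneq ltv => ->; lia.
  rewrite lerD2l (eq_bigl _ _ eqs) IH //.
  rewrite (cardsD1 u) inE uV ltu /= in leb.
  move: leb; rewrite add1n ltnS; congr (_ <= _)%N; apply: eq_card => v.
  by rewrite !inE -eqs; case: (v != u); rewrite ?andbT ?andbF.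
move=> leb; have [/existsP[v /andP[vV ltv]]|none] :=
    boolP [exists v, (v \in V) && lexlt k j v]; last first.
  rewrite big_pred0 ?gain_ge0 // => v; apply/negP => vP.
  by move/existsP: none; apply; exists v.
have [ltj|nout] := boolP [exists v, (v \in V) && (k == v.1 :> nat) && (j < v.2)%N].
  case/existsP: ltj => {ltv vV}v /andP[/andP[vV /eqP kv] ltv].
  have ltjn : (j < n)%N by have := ltn_ord v.2; lia.
  have uV := parent_closed_col (i := Ordinal (ltjn : (j.+1 < n.+1)%N)) clV vV ltv.
  have := step _ uV; rewrite /= {1}/lexlt /= -kv eqxx ltnS leqnn orbT.
  move=> /(_ isT _ leb) H; apply: le_trans (gain_out_le b k ltjn).
  rewrite /gain_out -addnS [in rho _]kv.
  rewrite [rho _](rhoE (v.1, Ordinal (ltjn : (j.+1 < n.+1)%N))); apply: H => x _.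
  rewrite /lexlt => ltx; case: (boolP ((k < x.1)%N || (k == x.1) && (j.+1 < x.2)%N)).
    by right.
  by move=> nx; left; apply: vertex_eq; rewrite /= -?kv; lia.
(* [V] has nothing further out in row [k], so [v] lies in a later row. *)
have ltk : (k < v.1)%N.
  move: ltv => /orP[//|/andP[kv jv]]; move/existsP: nout => [].
  by exists v; rewrite vV kv.
have ltkm : (k.+1 < m)%N by have := ltn_ord v.1; lia.
have uV := parent_closed_row (i := Ordinal ltkm) clV vV ltk.
have := step _ uV; rewrite r_col0 add0r {1}/lexlt /= ltnSn => /(_ isT _ leb) H.
apply: le_trans (gain_down_le b k j); rewrite /gain_down ltkm.
apply: H => x xV; rewrite /lexlt => ltx.
have nx : ~~ ((k == x.1) && (j < x.2)%N).
  by apply: contra nout => nx; apply/existsP; exists x; rewrite xV.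
case: (boolP ((k.+1 < x.1)%N || (k.+1 == x.1) && (0 < x.2)%N)); first by right.
by move=> nx'; left; apply: vertex_eq => /=; lia.
Qed.

(** The root has no reward, every other vertex comes after [(0, 0)], and by [closed_walk_visited] at
    most [b./2] of these are visited. *)
Lemma collected_le_gain b (w : seq (vertex m n)) : closed_walk w ->
  (cost w <= b)%N -> collected r w <= gain b./2 0 0.
Proof.
move=> cw leb; have [clV card] := closed_walk_visited cw.
case: w cw leb clV card => // v0 p /and3P[/andP[/eqP o1 /eqP o2] _ _] leb clV card.
have notlex : ~~ lexlt 0 0 v0 by rewrite /lexlt o1 o2.
have lexE v : v != v0 -> lexlt 0 0 v.
  apply: contraNT; rewrite /lexlt => nv.
  by apply/eqP/vertex_eq; rewrite ?o1 ?o2; lia.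
rewrite /collected (bigD1 v0) ?mem_head //=.
have -> : r v0 = 0.
  by rewrite (_ : v0 = (v0.1, ord0)) ?r_col0 //; apply: vertex_eq.
rewrite add0r; apply: le_trans (lex_sum_le_gain (j := 0) clV _); last first.
  have -> : [set v in [set x in v0 :: p] | lexlt 0 0 v] =
            [set x in v0 :: p] :\ v0.
    apply/setP => v; rewrite !inE; have [->|/=] := eqVneq v v0.
      by rewrite (negbTE notlex).
    by move/lexE->; rewrite andbT.
  move: card; rewrite (cardsD1 v0 [set x in _]) inE mem_head /= add0n.
  by move=> /leq_trans/(_ leb)/half_leq; rewrite mul2n doubleK.
rewrite le_eqVlt; apply/orP; left; apply/eqP; apply: eq_bigl => v.
rewrite !inE; have [->|/=] := eqVneq v v0; first by rewrite (negbTE notlex) andbF.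
by move/lexE->; rewrite andbT.
Qed.

End Value.

(** * Total correctness with a time bound *)

Section Halting.
Variable R : realType.
Implicit Types (s : state R) (p q : prog) (c : nat) (Q : state R -> Prop).

Definition halts_within p s c Q : Prop :=
  exists s' t, [/\ exec p s s' t, Q s' & (t <= c)%N].

Lemma halts_seq p q s c1 c2 Q1 Q2 : halts_within p s c1 Q1 ->
  (forall s', Q1 s' -> halts_within q s' c2 Q2) ->
  halts_within (Seq p q) s (c1 + c2) Q2.
Proof.
move=> [s1 [t1 [e1 /[swap] le1 /[swap] /[apply]]]] [s2 [t2 [e2 q2 le2]]].
by exists s2, (t1 + t2)%N; split; [apply: ExecSeq e1 e2| |apply: leq_add].
Qed.

(** [mu s] bounds the number of iterations; the last summand pays for the final failing test. *)
Lemma halts_while (I : state R -> Prop) (mu : state R -> nat) e p s c :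
  (forall s', I s' -> beval s' e ->
     halts_within p s' c (fun s'' => I s'' /\ (mu s'' < mu s')%N)) ->
  I s ->
  halts_within (While e p) s (mu s * (bexp_time e + c).+1 + (bexp_time e).+1)
    (fun s' => I s' /\ ~~ beval s' e).
Proof.
move=> step; have [d] := ubnP (mu s); elim: d s => // d IH s ltd Is.
have [be|be] := boolP (beval s e); last first.
  by exists s, (bexp_time e).+1; split; [apply: ExecWhileEnd| |rewrite leq_addl].
have [s1 [t1 [e1 [I1 lt1] le1]]] := step s Is be.
have [s2 [t2 [e2 Q2 le2]]] := IH s1 (leq_trans lt1 ltd) I1.
exists s2, (bexp_time e + t1 + t2).+1; split; [exact: ExecWhileStep e2|by []|].
have : ((mu s1).+1 * (bexp_time e + c).+1 <= mu s * (bexp_time e + c).+1)%N.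
  by rewrite leq_mul2r lt1 orbT.
lia.
Qed.

Fixpoint loop_free p : bool :=
  match p with
  | Seq p1 p2 | If _ p1 p2 => loop_free p1 && loop_free p2
  | While _ _ => false
  | _ => true
  end.

(* Meaningful for loop-free programs only, like [run_time] below. *)
Fixpoint run p s : state R :=
  match p with
  | Skip | While _ _ => s
  | NSet x e => set_nreg s x (neval s e)
  | NStore x i e => set_narr s x (neval s i) (neval s e)
  | RSet x e => set_rreg s x (reval s e)
  | RStore x i e => set_rarr s x (neval s i) (reval s e)
  | Seq p1 p2 => run p2 (run p1 s)
  | If e p1 p2 => if beval s e then run p1 s else run p2 s
  end.

Lemma run_seq p q s : run (Seq p q) s = run q (run p s).
Proof. by []. Qed.

Lemma run_if e p q s :
  run (If e p q) s = if beval s e then run p s else run q s.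
Proof. by []. Qed.

Fixpoint run_time p : nat :=
  match p with
  | Skip | While _ _ => 1
  | NSet _ e => (nexp_time e).+1
  | NStore _ i e => (nexp_time i + nexp_time e).+1
  | RSet _ e => (rexp_time e).+1
  | RStore _ i e => (nexp_time i + rexp_time e).+1
  | Seq p1 p2 => run_time p1 + run_time p2
  | If e p1 p2 => (bexp_time e + maxn (run_time p1) (run_time p2)).+1
  end.

Lemma halts_run p s Q : loop_free p -> Q (run p s) ->
  halts_within p s (run_time p) Q.
Proof.
move=> lf Qs.
suff [t [et let_]] : exists t, exec p s (run p s) t /\ (t <= run_time p)%N.
  by exists (run p s), t.
elim: p s lf {Qs} => //=.
- by move=> s _; exists 1%N; split => //; apply: ExecSkip.
- by move=> x e s _; eexists; split; [exact: ExecNSet|].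
- by move=> x i e s _; eexists; split; [exact: ExecNStore|].
- by move=> x e s _; eexists; split; [exact: ExecRSet|].
- by move=> x i e s _; eexists; split; [exact: ExecRStore|].
- move=> p IHp q IHq s /andP[/(IHp s)[t1 [e1 l1]] /(IHq (run p s))[t2 [e2 l2]]].
  by exists (t1 + t2)%N; split; [exact: ExecSeq e1 e2|apply: leq_add].
- move=> b p IHp q IHq s /andP[/(IHp s)[t1 [e1 l1]] /(IHq s)[t2 [e2 l2]]].
  have [bs|bs] := boolP (beval s b).
    exists (bexp_time b + t1).+1; split; last by lia.
    by apply: ExecIf; rewrite bs.
  exists (bexp_time b + t2).+1; split; last by lia.
  by apply: ExecIf; rewrite (negbTE bs).
Qed.

End Halting.

(** * The algorithm *)

(* [Xp] is the column of the robot, [Xj] the column of the state of the dynamic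
   program, [Xa] the address of that state's vertex and [Xx] the address of that
   state in the table, which is reward array 1. *)
Local Notation Xm := 0%N (only parsing).
Local Notation Xn := 1%N (only parsing).
Local Notation XB := 2%N (only parsing).
Local Notation XL := 3%N (only parsing).
Local Notation XN := 4%N (only parsing).
Local Notation Xb := 5%N (only parsing).
Local Notation Xk := 6%N (only parsing).
Local Notation Xj := 7%N (only parsing).
Local Notation Xa := 8%N (only parsing).
Local Notation Xx := 9%N (only parsing).
Local Notation Xp := 10%N (only parsing).

Local Notation NOne := (NConst 1).
Local Notation incr x := (NSet x (NAdd (NReg x) NOne)).
Local Notation decr x := (NSet x (NSub (NReg x) NOne)).
Local Notation "p ;; q" := (Seq p q) (at level 70, right associativity).

(** Naturals have no multiplication, so [m * n.+1] is summed up in [XN] in [m] rounds. *)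
Definition size_guard : bexp := NLe (NAdd (NReg Xk) NOne) (NReg Xm).
Definition size_body : prog :=
  NSet XN (NAdd (NReg XN) (NAdd (NReg Xn) NOne)) ;; incr Xk.

(** The sweep starts at layer 1: the cells of layer 0 already hold 0, the gain when no edge is left.
    [Xj] and [Xa] are still 0. *)
Definition table_init : prog :=
  NSet Xk (NConst 0) ;; NSet Xb NOne ;; NSet Xx (NReg XN).

(** The row-major distance from [(k, j)] to [(k.+1, 0)]. *)
Definition to_next_row : nexp := NSub (NAdd (NReg Xn) NOne) (NReg Xj).

Definition has_next_row : bexp := NLe (NAdd (NReg Xk) (NConst 2)) (NReg Xm).
Definition has_next_col : bexp := NLe (NAdd (NReg Xj) NOne) (NReg Xn).

Definition set_down : prog :=
  If has_next_row
     (RSet 0 (RArr 1 (NAdd (NSub (NReg Xx) (NReg XN)) to_next_row)))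
     (RSet 0 RZero).

Definition out_exp : rexp :=
  RAdd (RArr 0 (NAdd (NReg Xa) NOne))
       (RArr 1 (NAdd (NSub (NReg Xx) (NReg XN)) NOne)).

(** Reward register 0 is expected to hold the value of going down, left there by [set_down]. *)
Definition out_better : bexp := BAnd has_next_col (RLe (RReg 0) out_exp).

Definition next_state : prog :=
  incr Xx ;;
  If has_next_col
     (incr Xj ;; incr Xa)
     (NSet Xj (NConst 0) ;;
      If has_next_row
         (incr Xk ;; incr Xa)
         (NSet Xk (NConst 0) ;; NSet Xa (NConst 0) ;; incr Xb)).

(** This is [b <= B./2], tested without a division. *)
Definition table_guard : bexp := NLe (NAdd (NReg Xb) (NReg Xb)) (NReg XB).
Definition table_body : prog :=
  set_down ;; If out_better (RSet 0 out_exp) Skip ;;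
  RStore 1 (NReg Xx) (RReg 0) ;; next_state.

Definition emit : prog :=
  NStore 0 (NReg XL) (NAdd (NReg Xk) NOne) ;; NStore 1 (NReg XL) (NReg Xp) ;;
  incr XL.

(** The sweep ends on the first cell past the table; one layer back lies the initial state
    [(B./2, 0, 0)]. *)
Definition walk_init : prog :=
  decr Xb ;; NSet Xx (NSub (NReg Xx) (NReg XN)) ;; NSet Xp (NConst 0) ;;
  NSet XL (NConst 0) ;; emit.

Definition step_out : prog :=
  decr Xb ;; incr Xj ;; incr Xp ;; incr Xa ;;
  NSet Xx (NAdd (NSub (NReg Xx) (NReg XN)) NOne).

Definition step_down : prog :=
  decr Xb ;; NSet Xa (NAdd (NReg Xa) to_next_row) ;;
  NSet Xx (NAdd (NSub (NReg Xx) (NReg XN)) to_next_row) ;;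
  incr Xk ;; NSet Xj (NConst 0).

Definition walk_guard : bexp :=
  NLe NOne (NAdd (NReg Xb) (NAdd (NReg Xp) (NReg Xk))).
(** The order of the tests matters: go out while that is best, else return to column 0, then go
    down. With no row below, the edges left over are discarded, which emits no vertex, and only then
    does the robot climb to the root. *)
Definition walk_body : prog :=
  set_down ;;
  If (BAnd (NLe NOne (NReg Xb)) out_better) (step_out ;; emit)
  (If (NLe NOne (NReg Xp)) (decr Xp ;; emit)
  (If (BAnd (NLe NOne (NReg Xb)) has_next_row) (step_down ;; emit)
  (If (NLe NOne (NReg Xb)) (NSet Xb (NConst 0)) (decr Xk ;; emit)))).

Definition cop_sc_prog : prog :=
  While size_guard size_body ;; table_init ;; While table_guard table_body ;;
  walk_init ;; While walk_guard walk_body.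

Section Correctness.
Variables (R : realType) (m n B : nat) (r : vertex m n -> R) (rho : nat -> R).
Hypotheses (m_gt0 : (0 < m)%N) (rho_ge0 : forall a, 0 <= rho a).
Hypothesis rhoE : forall v, rho (address v) = r v.
Implicit Types s : state R.

Let N := (m * n.+1)%N.
Let H := B./2.
Let G := gain m n rho.
Let Gdown := gain_down m n rho.
Let Gout := gain_out m n rho.

(** * Layout of the table *)

Definition loc (k j : nat) : nat := (k * n.+1 + j)%N.

Lemma loc_lt k j : (k < m)%N -> (j <= n)%N -> (loc k j < N)%N.
Proof. by rewrite /loc /N => km jn; have := leq_mul km (leqnn n.+1); lia. Qed.

Lemma loc_inj k j k' j' : (j <= n)%N -> (j' <= n)%N -> loc k j = loc k' j' ->
  k = k' /\ j = j'.
Proof.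
rewrite /loc => jn jn' e; split.
  by have := congr1 (divn^~ n.+1) e; rewrite !divnMDl // !divn_small ?addn0.
by have := congr1 (modn^~ n.+1) e; rewrite !modnMDl !modn_small.
Qed.

(** State [(b, k, j)] occupies cell [b * N + loc k j]: the layer is the quotient by [N] and the
    vertex is the remainder. *)
Lemma table_inj b k j b' k' j' : (k < m)%N -> (j <= n)%N -> (k' < m)%N ->
  (j' <= n)%N -> (b * N + loc k j = b' * N + loc k' j')%N ->
  [/\ b = b', k = k' & j = j'].
Proof.
move=> km jn km' jn' e; have lt := loc_lt km jn; have lt' := loc_lt km' jn'.
have N0 : (0 < N)%N by apply: leq_ltn_trans lt.
have := congr1 (divn^~ N) e; rewrite !divnMDl // !divn_small // !addn0 => eb.
have := congr1 (modn^~ N) e; rewrite !modnMDl !modn_small // => el.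
by have [] := loc_inj jn jn' el.
Qed.

Lemma loc_next_row k j : (j <= n)%N -> loc k.+1 0 = (loc k j + (n + 1 - j))%N.
Proof. by rewrite /loc mulSn; lia. Qed.

(** * Evaluating the two choices from the table *)

Definition regs_ok s : Prop :=
  [/\ nreg s Xm = m, nreg s Xn = n, nreg s XB = B, nreg s XN = N
    & forall a, rarr s 0 a = rho a].

Definition at_state s b k j : Prop :=
  [/\ nreg s Xb = b, nreg s Xk = k, nreg s Xj = j, nreg s Xa = loc k j
    & nreg s Xx = (b * N + loc k j)%N].

Definition table_ok s x : Prop := forall b k j, (k < m)%N -> (j <= n)%N ->
  (b * N + loc k j < x)%N -> rarr s 1 (b * N + loc k j) = G b k j.

(** A state of layer [b.+1] reads only layer [b], so filled cells below [b.+1 * N] suffice. *)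
Lemma run_set_down s b k j : regs_ok s -> at_state s b.+1 k j ->
  table_ok s (b.+1 * N) -> (j <= n)%N ->
  run set_down s = set_rreg s 0 (Gdown b k).
Proof.
move=> [em en eB eN er] [eb ek ej ea ex] tab jn.
rewrite /= em ek addn2 /Gdown /gain_down.
case: ifP => km //=; rewrite ex eN en ej; congr (set_rreg _ _ _).
rewrite mulSn -addnA addKn -addnA -(loc_next_row k jn) tab //.
by rewrite mulSn; have := loc_lt km (leq0n n); lia.
Qed.

Lemma reval_out s b k j : regs_ok s -> at_state s b.+1 k j ->
  table_ok s (b.+1 * N) -> (k < m)%N -> (j < n)%N ->
  reval s out_exp = Gout b k j.
Proof.
move=> [em en eB eN er] [eb ek ej ea ex] tab km jn /=.
rewrite er ea ex eN mulSn -addnA addKn addn1 /Gout /gain_out.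
have -> : (b * N + loc k j + 1 = b * N + loc k j.+1)%N by rewrite /loc; lia.
by rewrite tab // mulSn; have := loc_lt km jn; lia.
Qed.

Definition out_wins b k j : bool :=
  (j < n)%N && (Gdown b k <= Gout b k j).

Lemma beval_out s b k j : regs_ok s -> at_state s b.+1 k j ->
  table_ok s (b.+1 * N) -> (k < m)%N ->
  beval (set_rreg s 0 (Gdown b k)) out_better = out_wins b k j.
Proof.
move=> ok st tab km; have [_ en _ _ _] := ok; have [_ _ ej _ _] := st.
rewrite /out_better /out_wins.
transitivity ((j < n)%N && (Gdown b k <= reval s out_exp)).
  by rewrite /= en ej addn1.
(* In the last column [out_exp] reads meaningless cells, but the conjunction is then false
   anyway. *)
by case: ltnP => //= jn; rewrite -(reval_out ok st tab km jn).
Qed.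

(** * The number of vertices *)

Lemma halts_size s : nreg s Xm = m -> nreg s Xn = n -> nreg s XB = B ->
  nreg s XN = 0%N -> nreg s Xk = 0%N -> nreg s Xj = 0%N -> nreg s Xa = 0%N ->
  (forall a, rarr s 0 a = rho a) -> (forall a, rarr s 1 a = 0) ->
  halts_within (While size_guard size_body) s
    (m * (bexp_time size_guard + run_time size_body).+1
       + (bexp_time size_guard).+1)
    (fun s => [/\ regs_ok s, nreg s Xj = 0%N, nreg s Xa = 0%N
                & forall a, rarr s 1 a = 0]).
Proof.
move=> em en eB eN ek ej ea e0 e1.
(* The zeros in [Xj], [Xa] and the table are carried along because [table_init] relies on them. *)
pose I s := [/\ [/\ nreg s Xm = m, nreg s Xn = n & nreg s XB = B],
  nreg s XN = (nreg s Xk * n.+1)%N /\ (nreg s Xk <= m)%N,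
  nreg s Xj = 0%N /\ nreg s Xa = 0%N,
  forall a, rarr s 0 a = rho a & forall a, rarr s 1 a = 0].
have Is : I s by rewrite /I eN ek.
have [] := @halts_while R I (fun s => m - nreg s Xk)%N size_guard size_body s
  (run_time size_body) _ Is.
  move=> {Is em en eB eN ek ej ea e0 e1} {}s.
  move=> [[em en eB] [eN lek] [ej ea] e0 e1] /=; rewrite em => lek'.
  apply: halts_run => //; split; rewrite ?/I /= /upd /=; last by lia.
  by split=> //=; split => //; rewrite ?eN ?en; lia.
move=> s' [t [ex [[[em' en' eB'] [eN' lek] [ej' ea'] e0' e1'] ng] le]].
exists s', t; split => //; last by rewrite ek subn0 in le.
split=> //; split=> //; rewrite eN' /N; congr (_ * _)%N.
by move: ng => /=; rewrite em'; lia.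
Qed.

(** * Filling the table *)

Definition table_inv s : Prop := exists b k j,
  [/\ regs_ok s, at_state s b k j,
      [/\ (0 < b)%N, (k < m)%N & (j <= n)%N],
      (b <= H)%N \/ [/\ b = H.+1, k = 0%N & j = 0%N]
    & table_ok s (b * N + loc k j)].

(** Successive states have successive cells: after the last column comes column 0 of the next row,
    and after the last vertex the first cell of the next layer. *)
Lemma run_next_state s b k j : regs_ok s -> at_state s b k j ->
  (k < m)%N -> (j <= n)%N ->
  exists b' k' j', [/\ regs_ok (run next_state s),
    at_state (run next_state s) b' k' j', (k' < m)%N /\ (j' <= n)%N,
    b' = b \/ [/\ b' = b.+1, k' = 0%N & j' = 0%N]
    & (b' * N + loc k' j' = (b * N + loc k j).+1)%N
      /\ rarr (run next_state s) = rarr s].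
Proof.
move=> [em en eB eN er] [eb ek ej ea ex] km jn.
rewrite /next_state run_seq run_if /=.
rewrite /upd /= ej en addn1; case: ltnP => jn'.
  exists b, k, j.+1; rewrite /regs_ok /at_state /= /upd /= ?ej ?ea ?ex.
  by rewrite /loc; split=> //; [|left|]; split=> //; lia.
have {jn'}jn : j = n by lia.
rewrite ek em addn2; case: ltnP => km'.
  exists b, k.+1, 0%N; rewrite /regs_ok /at_state /= /upd /= ?ek ?ea ?ex.
  have -> : loc k.+1 0 = (loc k j).+1 by rewrite /loc jn mulSn; lia.
  by split=> //; [|left|]; split=> //; lia.
exists b.+1, 0%N, 0%N; rewrite /regs_ok /at_state /= /upd /= ?eb ?ex.
have -> : (b.+1 * N + loc 0 0 = (b * N + loc k j).+1)%N.
  by rewrite mulSn /loc jn /N (_ : m = k.+1) ?[(k.+1 * _)%N]mulSn; lia.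
by split=> //; [split=> //; lia|right].
Qed.

Lemma table_body_inv s : table_inv s -> beval s table_guard ->
  table_inv (run table_body s) /\
  (H.+1 * N - nreg (run table_body s) Xx < H.+1 * N - nreg s Xx)%N.
Proof.
move=> [[|b] [k [j [ok st [// _ km jn] leb tab]]]] guard.
have [em en eB eN er] := ok; have [eb ek ej ea ex] := st.
have {}leb : (b < H)%N by move: guard; rewrite /= eB eb /H; lia.
have tab' : table_ok s (b.+1 * N).
  by move=> b' k' j' km' jn' lt; apply: tab => //; lia.
(* [f] abstracts the reward registers, of which only register 0 matters: it holds the value to be
   stored. *)
have [f [f0 fE]] : exists f, f 0%N = G b.+1 k j /\
    run (set_down ;; If out_better (RSet 0 out_exp) Skip) s
    = State (nreg s) (narr s) f (rarr s).
  rewrite run_seq (run_set_down ok st tab' jn) run_if (beval_out ok st tab' km).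
  rewrite /G gainS -/(out_wins b k j); case: ifP => wins; (eexists; split; last by []) => //.
  by case/andP: wins => jlt _; exact: (reval_out ok st tab' km jlt).
have -> : run table_body s = run next_state
    (set_rarr (State (nreg s) (narr s) f (rarr s)) 1 (nreg s Xx) (f 0%N)).
  by rewrite /table_body 3!run_seq -[run _ (run set_down s)]run_seq fE.
rewrite f0 {f0 fE}; set s1 := set_rarr _ _ _ _.
(* By [table_inj], the written cell belongs to the current state alone. *)
have tab1 b' k' j' : (k' < m)%N -> (j' <= n)%N ->
    (b' * N + loc k' j' <= b.+1 * N + loc k j)%N ->
    rarr s1 1 (b' * N + loc k' j') = G b' k' j'.
  move=> km' jn'; rewrite /s1 /= /upd /= ex leq_eqVlt.
  by have [e _|_ /=] := eqVneq; [have [-> -> ->] := table_inj km' jn' km jn e|exact: tab].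
have ltx : (b.+1 * N + loc k j < H.+1 * N)%N.
  apply: leq_trans (_ : b.+2 * N <= _)%N; last by rewrite leq_mul2r !ltnS leb orbT.
  by rewrite [(b.+2 * N)%N]mulSn; have := loc_lt km jn; lia.
have [b' [k' [j' [ok' st' [km' jn'] bE [xE arrE]]]]] :=
  @run_next_state s1 b.+1 k j ok st km jn.
have ex' : nreg (run next_state s1) Xx = (nreg s Xx).+1.
  by case: st' => _ _ _ _ ->; rewrite xE ex.
split; last by rewrite ex' ex; lia.
exists b', k', j'; split=> //.
- by split=> //; case: bE => [->|[-> _ _]].
(* Leaving layer [H] ends the sweep on the first cell of layer [H.+1]. *)
- case: bE => [->|[-> -> ->]]; first by left.
  by case: (ltnP b.+1 H) => lt; [left|right; split=> //; lia].
- by rewrite xE /table_ok arrE => b2 k2 j2 ? ?; rewrite ltnS; exact: tab1.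
Qed.

Lemma halts_table s : table_inv s ->
  halts_within (While table_guard table_body) s
    (H * N * (bexp_time table_guard + run_time table_body).+1
       + (bexp_time table_guard).+1)
    (fun s => [/\ regs_ok s, at_state s H.+1 0 0 & table_ok s (H.+1 * N)]).
Proof.
(* The sweep is in layer 1 or later, so at most [H * N] cells remain to be filled. *)
move=> inv; have lex : (H.+1 * N - nreg s Xx <= H * N)%N.
  case: inv => [[|b] [k [j [_ [_ _ _ _ ->] [// _ _ _] _ _]]]].
  by rewrite !mulSn; lia.
have [] := @halts_while R table_inv (fun s => H.+1 * N - nreg s Xx)%N
  table_guard table_body s (run_time table_body) _ inv.
  by move=> s' inv' guard; apply: halts_run => //; exact: table_body_inv.
move=> s' [t [ex [[b [k [j [ok st [b0 _ _] bE tab]]]] ng] le]].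
exists s', t; split=> //; last first.
  by apply: leq_trans le _; rewrite leq_add2r leq_mul2r lex orbT.
move: ng; have [_ _ eB _ _] := ok; have [eb _ _ _ _] := st.
rewrite /= eB eb; case: bE => [leb|[bE kE jE]] ng.
  by move: leb; rewrite /H; lia.
by move: st tab; rewrite bE kE jE addn0.
Qed.

(** * Reading the tour off the table *)

Definition writes s (v0 : vertex m n) q : Prop :=
  output s = walk_code (v0 :: q) /\ nreg s XL = (size q).+1.

Lemma output_emit s : output (run emit s) =
  rcons (output s) ((nreg s Xk).+1, nreg s Xp).
Proof.
rewrite /output /= /upd /= addn1 addn1 -[in iota _ _]addn1 iotaD map_cat cats1.
congr rcons; last by rewrite add0n !eqxx.
apply/eq_in_map => i; rewrite mem_iota add0n => /andP[_ lt].
by rewrite !ltn_eqF.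
Qed.

Lemma writes_emit s v0 q (y : vertex m n) : writes s v0 q ->
  nreg s Xk = y.1 -> nreg s Xp = y.2 -> writes (run emit s) v0 (rcons q y).
Proof.
move=> [oE lE] ek ep; split.
  by rewrite output_emit oE ek ep -rcons_cons /walk_code map_rcons.
by rewrite /= /upd /= lE size_rcons addn1.
Qed.

(* On the way back to column 0 ([p < j]) the state (b, k, j) does not move, so
   that the choice recomputed at every step stays the same. Once [b = 0] the
   robot only returns to the root, and the other state registers are junk. *)
Definition walk_inv s : Prop :=
  let b := nreg s Xb in let k := nreg s Xk in
  let j := nreg s Xj in let p := nreg s Xp in
  exists v0 q, let v := last v0 q in
  [/\ [/\ regs_ok s, table_ok s (H.+1 * N) & (b <= H)%N],
      [/\ writes s v0 q, is_origin v0 & path (@adj m n) v0 q],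
      [/\ v.1 = k :> nat, v.2 = p :> nat & (size q + 2 * b + p + k <= 2 * H)%N],
      G H 0 0 <= collected r (v0 :: q) + G b k j
    & (0 < b)%N ->
      [/\ at_state s b k j, (j <= n)%N, (p <= j)%N, p = j \/ ~~ out_wins b.-1 k j
        & {in v0 :: q, forall u, ~~ lexlt k j u}]].

Definition walk_measure s : nat := (2 * nreg s Xb + nreg s Xp + nreg s Xk)%N.

Lemma r_ge0 v : 0 <= r v.
Proof. by rewrite -rhoE. Qed.

Lemma collected_rcons l y :
  collected r (rcons l y) = (if y \in l then 0 else r y) + collected r l.
Proof.
rewrite /collected; case: ifPn => yl.
  rewrite add0r; apply: eq_bigl => v; rewrite mem_rcons inE.
  by case: eqP => // ->.
rewrite (bigD1 y) ?mem_rcons ?mem_head //=; congr (_ + _).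
apply: eq_bigl => v; rewrite mem_rcons inE.
by have [->|_] := eqVneq v y; rewrite ?(negbTE yl) ?andbT.
Qed.

Lemma collected_rcons_le l y : collected r l <= collected r (rcons l y).
Proof. by rewrite collected_rcons lerDr; case: ifP => // _; apply: r_ge0. Qed.

Lemma vertex_at k j : (k < m)%N -> (j <= n)%N ->
  exists v : vertex m n, v.1 = k :> nat /\ v.2 = j :> nat.
Proof.
by move=> km jn; exists (Ordinal km, Ordinal (jn : (j < n.+1)%N)).
Qed.

Lemma hedge_nat (u v : vertex m n) :
  u.1 = v.1 :> nat -> v.2 = u.2.+1 :> nat -> hedge u v.
Proof. by rewrite /hedge => /val_inj -> ->; rewrite !eqxx. Qed.

(** Every move of the robot ends with [emit]. Here [s] already has the moved registers but [y] is
    not yet written, so the length bound is strict to leave room for [y]. *)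
Lemma walk_inv_emit s v0 q (y : vertex m n) :
  let b := nreg s Xb in let k := nreg s Xk in
  let j := nreg s Xj in let p := nreg s Xp in
  regs_ok s -> table_ok s (H.+1 * N) -> (b <= H)%N ->
  writes s v0 q -> is_origin v0 -> path (@adj m n) v0 q ->
  adj (last v0 q) y -> k = y.1 -> p = y.2 ->
  (size q + 2 * b + p + k < 2 * H)%N ->
  G H 0 0 <= collected r (rcons (v0 :: q) y) + G b k j ->
  ((0 < b)%N -> [/\ at_state s b k j, (j <= n)%N, (p <= j)%N,
      p = j \/ ~~ out_wins b.-1 k j
    & {in rcons (v0 :: q) y, forall u, ~~ lexlt k j u}]) ->
  walk_inv (run emit s).
Proof.
move=> b k j p ok tab bH wr ov pq ay ky py sz val st.
exists v0, (rcons q y); rewrite last_rcons; split.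
- by [].
- by split; [exact: writes_emit| |rewrite rcons_path pq].
- by split; rewrite ?size_rcons // addSn.
- exact: val.
- exact: st.
Qed.

(** No branch increases [size q + 2 * b + p + k]: a step out or down spends one edge, worth 2, on
    one more vertex of the walk and one more unit of distance; a step back trades distance for
    length. The collected reward plus the remaining gain never decreases. *)
Lemma walk_body_inv s : walk_inv s -> beval s walk_guard ->
  walk_inv (run walk_body s) /\
  (walk_measure (run walk_body s) < walk_measure s)%N.
Proof.
move=> [v0 [q [[ok tab bH] [wr ov pq] [vk vp sz] val st]]] guard.
have [em en eB eN er] := ok.
have km : (nreg s Xk < m)%N by rewrite -vk.
have tabb b : (b <= H)%N -> table_ok s (b.+1 * N).
  move=> leb b' k' j' km' jn' lt; apply: tab => //; apply: leq_trans lt _.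
  by rewrite leq_mul2r ltnS leb orbT.
rewrite /walk_body run_seq run_if.
set out := beval _ _.
have outE b : nreg s Xb = b.+1 -> out = out_wins b (nreg s Xk) (nreg s Xj).
  move=> bE; have [|at_s jn _ _ _] := st; first by rewrite bE.
  rewrite bE in at_s; rewrite bE in bH.
  rewrite /out [LHS]/((0 < nreg (run set_down s) Xb)%N && beval _ out_better).
  have tb := tabb _ (ltnW bH).
  by rewrite (run_set_down ok at_s tb jn) (beval_out ok at_s tb km) /= bE.
have out0 : nreg s Xb = 0%N -> out = false.
  by rewrite /out /set_down run_if; case: ifP => _ /= ->.
have [f ->] : exists f, run set_down s = State (nreg s) (narr s) f (rarr s).
  by rewrite /set_down run_if; case: ifP => _; eexists.
set s1 := State _ _ _ _.
have gain_notout b : nreg s Xb = b.+1 -> out = false ->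
    G b.+1 (nreg s Xk) (nreg s Xj) = Gdown b (nreg s Xk).
  by move=> bE; rewrite (outE _ bE) /G gainS -/(out_wins _ _ _) => ->.
have [outT|outF] := boolP out.
  case bE: (nreg s Xb) => [|b]; first by rewrite out0 in outT.
  have [|[_ _ ej ea ex] _ _ pj fresh] := st; first by rewrite bE.
  (* Going out is best, so the invariant leaves only [p = j]: the robot stands at the vertex of the
     state. *)
  rewrite bE /= -(outE _ bE) outT in pj; have {}pj : nreg s Xp = nreg s Xj.
    by case: pj.
  rewrite (outE _ bE) in outT; have /andP[jn _] := outT.
  have [y [yk yj]] := vertex_at km jn.
  (* [y] comes after [(k, j)], where nothing has been visited yet, so its reward is new. *)
  have ynew : y \notin v0 :: q.
    by apply/negP => /fresh; rewrite /lexlt yk yj eqxx ltnS leqnn orbT.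
  split; last by rewrite run_seq /walk_measure /= /upd /= bE; lia.
  have gE : G b.+1 (nreg s Xk) (nreg s Xj) =
            r y + G b (nreg s Xk) (nreg s Xj).+1.
    rewrite /G gainS -/(out_wins _ _ _) outT; congr (_ + _).
    by rewrite -rhoE /address yk yj addnS.
  rewrite run_seq.
  apply: (walk_inv_emit (v0 := v0) (q := q) (y := y));
    rewrite ?/regs_ok ?/at_state /= /upd /= ?bE ?subn1 ?addn1 //; try lia.
  + by rewrite adj_parent /parent hedge_nat ?vk ?yk // vp yj pj.
  + rewrite -rcons_cons collected_rcons (negbTE ynew).
    by rewrite bE gE in val; lra.
  + move=> b0; split=> //.
    * by rewrite ea ex bE eN mulSn /loc; split=> //; lia.
    * by rewrite pj.
    * by left; rewrite pj.
    * move=> u; rewrite -rcons_cons mem_rcons inE => /orP[/eqP->|/fresh].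
        by rewrite /lexlt yk yj; lia.
      by rewrite /lexlt; lia.
rewrite run_if (_ : beval s1 _ = (0 < nreg s Xp)%N) //.
have [p0|p0] := boolP (0 < nreg s Xp)%N.
  have lp : ((nreg s Xp).-1 <= n)%N by have := ltn_ord (last v0 q).2; rewrite vp; lia.
  have [y [yk yj]] := vertex_at km lp.
  split; last by rewrite run_seq /walk_measure /= /upd /=; lia.
  rewrite run_seq.
  apply: (walk_inv_emit (v0 := v0) (q := q) (y := y));
    rewrite ?/regs_ok ?/at_state /= /upd /= ?subn1 ?addn1 //; try lia.
  + by rewrite adj_parent /parent (hedge_nat (u := y)) ?orbT // ?vp ?vk ?yk ?yj //; lia.
  + by apply: le_trans val _; rewrite lerD2r -rcons_cons collected_rcons_le.
  + move=> b0; have [at_s jn pj _ fresh] := st b0; split=> //; try lia.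
      (* The state has not moved, so going out still loses. *)
      by right; case bE: (nreg s Xb) b0 => [//|b] _; rewrite -(outE _ bE).
    move=> u; rewrite -rcons_cons mem_rcons inE => /orP[/eqP->|/fresh//].
    by rewrite /lexlt yk yj; lia.
have {}p0 : nreg s Xp = 0%N by lia.
rewrite run_if (_ : beval s1 _ =
  (0 < nreg s Xb)%N && (nreg s Xk + 2 <= nreg s Xm)%N) //.
have [/andP[b0 km1]|nodown] := boolP ((0 < nreg s Xb)%N && _).
  have {}km1 : ((nreg s Xk).+1 < m)%N by rewrite em in km1; lia.
  case bE: (nreg s Xb) b0 => [//|b] _.
  have [|[_ _ ej ea ex] jn _ _ fresh] := st; first by rewrite bE.
  have [y [yk yj]] := vertex_at km1 (leq0n n).
  split; last by rewrite run_seq /walk_measure /= /upd /= bE; lia.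
  have gE : G b.+1 (nreg s Xk) (nreg s Xj) = G b (nreg s Xk).+1 0.
    by rewrite gain_notout ?(negbTE outF) // /Gdown /gain_down km1.
  rewrite run_seq.
  apply: (walk_inv_emit (v0 := v0) (q := q) (y := y));
    rewrite ?/regs_ok ?/at_state /= /upd /= ?bE ?subn1 ?addn1 ?p0 //; try lia.
  + by rewrite adj_parent /parent /vedge vp vk yk yj p0 !eqxx !orbT.
  (* The gain counts nothing for [y]; its nonnegative reward can only help. *)
  + apply: le_trans val _; rewrite bE gE.
    by rewrite lerD2r -rcons_cons collected_rcons_le.
  + move=> b0; split=> //; last first.
    * move=> u; rewrite -rcons_cons mem_rcons inE => /orP[/eqP->|/fresh].
        by rewrite /lexlt yk yj; lia.
      by rewrite /lexlt; lia.
    * by left.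
    rewrite ea ex bE eN en mulSn (loc_next_row _ jn) addn1; split=> //; lia.
rewrite run_if (_ : beval s1 _ = (0 < nreg s Xb)%N) //.
have [b0|b0] := boolP (0 < nreg s Xb)%N.
  split; last by rewrite /walk_measure /= /upd /=; lia.
  case bE: (nreg s Xb) b0 => [//|b] _.
  exists v0, q; rewrite /walk_inv /regs_ok /= /upd /=; split=> //; [split=> //; lia|].
  (* Going out loses and there is no row below, so the remaining gain is 0 and discarding the edges
     costs nothing. *)
  apply: le_trans val _; rewrite bE gain_notout ?(negbTE outF) //.
  rewrite /Gdown /gain_down ifF //.
  by move: nodown; rewrite bE em; lia.
have {}b0 : nreg s Xb = 0%N by lia.
have k0 : (0 < nreg s Xk)%N by move: guard; rewrite /= p0 b0.
have [|y [yk yj]] := @vertex_at (nreg s Xk).-1 0%N _ (leq0n n); first by lia.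
split; last by rewrite run_seq /walk_measure /= /upd /=; lia.
rewrite run_seq.
apply: (walk_inv_emit (v0 := v0) (q := q) (y := y));
  rewrite ?/regs_ok ?/at_state /= /upd /= ?subn1 ?addn1 ?p0 ?b0 //; try lia.
+ by rewrite adj_parent /parent /vedge vp vk yk yj p0 prednK // !eqxx !orbT.
+ apply: le_trans val _; rewrite b0.
  by rewrite lerD2r -rcons_cons collected_rcons_le.
Qed.

(** On exit [b = p = k = 0]: the walk is back at the root, its length is at most [2 * H <= B], and
    the remaining gain is 0, so the whole value has been collected. *)
Lemma halts_walk s : walk_inv s ->
  halts_within (While walk_guard walk_body) s
    (B * (bexp_time walk_guard + run_time walk_body).+1
       + (bexp_time walk_guard).+1)
    (fun s => exists w, [/\ output s = walk_code w, closed_walk w,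
       (cost w <= B)%N & G H 0 0 <= collected r w]).
Proof.
move=> inv; have lex : (walk_measure s <= B)%N.
  case: inv => [v0 [q [_ _ [_ _ sz] _ _]]].
  by move: sz; rewrite /walk_measure /H; lia.
have [] := @halts_while R walk_inv walk_measure
  walk_guard walk_body s (run_time walk_body) _ inv.
  by move=> s' inv' guard; apply: halts_run => //; exact: walk_body_inv.
move=> s' [t [ex [[v0 [q [_ [[oE _] ov pq] [vk vp sz] val _]]] ng] le]].
exists s', t; split=> //; last first.
  by apply: leq_trans le _; rewrite leq_add2r leq_mul2r lex orbT.
have {ng}[b0 p0 k0] : [/\ nreg s' Xb = 0%N, nreg s' Xp = 0%N & nreg s' Xk = 0%N].
  by move: ng => /= ng; split; lia.
exists (v0 :: q); split=> //.
- rewrite /closed_walk ov pq; apply/eqP/vertex_eq.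
    by rewrite vk k0; case/andP: ov => /eqP->.
  by rewrite vp p0; case/andP: ov => _ /eqP->.
- by move: sz; rewrite /cost /= /H; lia.
- by rewrite b0 addr0 in val.
Qed.

(** * Assembling the phases *)

Lemma table_init_inv s : regs_ok s -> nreg s Xj = 0%N -> nreg s Xa = 0%N ->
  (forall a, rarr s 1 a = 0) -> table_inv (run table_init s).
Proof.
move=> [em en eB eN er] ej ea e1; exists 1%N, 0%N, 0%N.
rewrite /regs_ok /at_state /= /upd /= mul1n addn0; split=> //.
(* If [H = 0], layer 1 is already the end of the sweep. *)
- by case: (posnP H) => [->|]; [right|left].
- case=> [|b] k j km jn /=; first by rewrite e1.
  by rewrite mulSn; lia.
Qed.

Lemma walk_init_inv s : regs_ok s -> at_state s H.+1 0 0 ->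
  table_ok s (H.+1 * N) -> walk_inv (run walk_init s).
Proof.
move=> [em en eB eN er] [eb ek ej ea ex] tab.
have [v0 [vk vj]] := vertex_at m_gt0 (leq0n n).
exists v0, [::]; rewrite /walk_inv /regs_ok /at_state /writes /output.
rewrite /= /upd /= eb ek ej ea ex eN vk vj mulSn subn1 !addn0 addKn /=.
split=> //; first by rewrite /is_origin vk vj.
  rewrite lerDr sumr_ge0 // => v _; exact: r_ge0.
move=> H0; split=> //; [by left|].
by move=> u; rewrite inE => /eqP->; rewrite /lexlt vk vj.
Qed.

(** The costs per iteration of the three loops, plus everything executed once, which
    [1 <= m * n * B] absorbs. The 3 belongs to the final failing tests. *)
Definition cop_sc_time : nat :=
  ((bexp_time size_guard + run_time size_body).+1
   + 2 * (bexp_time table_guard + run_time table_body).+1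
   + (bexp_time walk_guard + run_time walk_body).+1
   + (bexp_time size_guard + bexp_time table_guard + bexp_time walk_guard
      + run_time table_init + run_time walk_init + 3))%N.

Lemma halts_cop_sc s : nreg s Xm = m -> nreg s Xn = n -> nreg s XB = B ->
  nreg s XN = 0%N -> nreg s Xk = 0%N -> nreg s Xj = 0%N -> nreg s Xa = 0%N ->
  (forall a, rarr s 0 a = rho a) -> (forall a, rarr s 1 a = 0) ->
  (0 < n)%N -> (0 < B)%N ->
  halts_within cop_sc_prog s (cop_sc_time * (m * n * B))
    (fun s => exists w, [/\ output s = walk_code w, closed_walk w,
       (cost w <= B)%N & G H 0 0 <= collected r w]).
Proof.
move=> em en eB eN ek ej ea e0 e1 n0 B0.
pose Q s := exists w, [/\ output s = walk_code w, closed_walk w,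
       (cost w <= B)%N & G H 0 0 <= collected r w].
suff [s' [t [ex Qs le]]] : halts_within cop_sc_prog s
    ((m * (bexp_time size_guard + run_time size_body).+1
       + (bexp_time size_guard).+1) +
     (run_time table_init +
      ((H * N * (bexp_time table_guard + run_time table_body).+1
         + (bexp_time table_guard).+1) +
       (run_time walk_init +
        (B * (bexp_time walk_guard + run_time walk_body).+1
          + (bexp_time walk_guard).+1))))) Q.
  exists s', t; split=> //; apply: leq_trans le _; rewrite /cop_sc_time.
  set D := (m * n * B)%N.
  have D1 : (1 <= D)%N by rewrite /D !muln_gt0 m_gt0 n0.
  have Dm : (m <= D)%N by rewrite /D -mulnA leq_pmulr // muln_gt0 n0.
  have DB : (B <= D)%N by rewrite /D leq_pmull // muln_gt0 m_gt0.
  have DH : (H * N <= 2 * D)%N.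
    (* Column 0 is absorbed into a factor 2, as [n] is positive. *)
    have nn : (n.+1 <= 2 * n)%N by lia.
    have HB : (2 * H <= B)%N by rewrite /H; lia.
    have := leq_mul (leq_mul (leqnn m) nn) HB; rewrite /N /D; lia.
  move: (bexp_time size_guard) (run_time size_body) (bexp_time table_guard)
    (run_time table_body) (bexp_time walk_guard) (run_time walk_body)
    (run_time table_init) (run_time walk_init) => t1 t2 t3 t4 t5 t6 t7 t8.
  have := leq_mul Dm (leqnn (t1 + t2).+1).
  have := leq_mul DH (leqnn (t3 + t4).+1).
  have := leq_mul DB (leqnn (t5 + t6).+1).
  have := leq_mul D1 (leqnn (t1 + t3 + t5 + t7 + t8 + 3)).
  lia.
apply: halts_seq (halts_size em en eB eN ek ej ea e0 e1) _ => s1 [ok ej1 ea1 e11].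
apply: halts_seq (halts_run (Q := table_inv) _ _) _ => //.
  exact: table_init_inv.
move=> s2 inv2; apply: halts_seq (halts_table inv2) _ => s3 [ok3 at3 tab3].
apply: halts_seq (halts_run (Q := walk_inv) _ _) _ => //.
  exact: walk_init_inv.
by move=> s4 inv4; exact: halts_walk.
Qed.

End Correctness.

Lemma address_inj m n : injective (@address m n).
Proof.
move=> u v e; have bound (w : vertex m n) : (w.2 <= n)%N by rewrite -ltnS.
by have [] := loc_inj (bound u) (bound v) e; exact: vertex_eq.
Qed.

Theorem theorem3 (R : realType) :
  exists (P : prog) (C : nat),
    forall (m n B : nat) (r : vertex m n -> R),
      (1 <= m)%N -> (1 <= n)%N -> (0 < B)%N ->
      (forall v, 0 <= r v) ->
      (forall i : 'I_m, r (i, ord0) = 0) ->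
      exists (s : state R) (t : nat) (w : seq (vertex m n)),
        [/\ exec P (input_state r B) s t,
            output s = walk_code w,
            cop_sc_optimal r B w
          & t%:R <= C%:R * (m%:R * n%:R * (B%:R / 2)) :> R].
Proof.
(* The factor 2 cancels the division of [B] by 2 in the bound. *)
exists cop_sc_prog, (cop_sc_time * 2)%N => m n B r m0 n0 B0 r0 rcol.
pose rho := rarr (input_state r B) 0.
(* An address that belongs to no vertex holds 0. *)
have rho_ge0 a : 0 <= rho a by rewrite /rho /=; case: pickP.
have rhoE v : rho (address v) = r v.
  rewrite /rho /=; case: pickP => [u /eqP/address_inj->//|/(_ v)].
  by rewrite eqxx.
have [s [t [ex [w [oE cw cB opt]] le]]] := @halts_cop_sc R m n B r rho m0 rho_ge0
  rhoE (input_state r B) erefl erefl erefl erefl erefl erefl erefl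
  (fun=> erefl) (fun=> erefl) n0 B0.
exists s, t, w; split=> //.
  split=> // w' cw' cB'; apply: le_trans opt.
  exact: (@collected_le_gain R m n rho rho_ge0 r rhoE rcol).
have -> : (cop_sc_time * 2)%:R * (m%:R * n%:R * (B%:R / 2)) =
          (cop_sc_time * (m * n * B))%:R :> R by rewrite !natrM; field.
by rewrite ler_nat.
Qed.
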